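(* Let $(a_1,\dots,a_n)$ and $(b_1,\dots,b_k)$ be finite non-increasing sequences of positive integers with $(a_1,\dots,a_n)\succ(b_1,\dots,b_k)$. Then $a_1!\,a_2!\cdots a_n!\ \ge\ b_1!\,b_2!\cdots b_k!$. Moreover, equality holds if and only if $n=k$ and $a_j=b_j$ for all $j$.
   Context: Majorization: for finite non-increasing sequences of positive integers $(a_1,\dots,a_n)$ and $(b_1,\dots,b_k)$, write $(a_1,\dots,a_n)\succ(b_1,\dots,b_k)$ if all of the following hold: (1) $n\le k$; (2) for every $i\le n$, $a_1+\dots+a_i\ge b_1+\dots+b_i$; (3) $a_1+\dots+a_n\ge b_1+\dots+b_k$. *)

(* Defs.v *)
From mathcomp Require Import all_boot.

Set Implicit Arguments.
Unset Strict Implicit.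
Unset Printing Implicit Defensive.

(* The finite sequence (a_1, ..., a_n) is [a : seq nat], with n = size a;
   sumn (take i a) is a_1 + ... + a_i. *)

Definition nonincreasing_pos (a : seq nat) : Prop :=
  sorted geq a /\ (forall x, x \in a -> 0 < x).

(* Intended only for sequences satisfying [nonincreasing_pos]. The two sequences may
   have different lengths and different sums, so this is not the usual majorization. *)
Definition majorizes (a b : seq nat) : Prop :=
  [/\ size a <= size b,
      forall i, i <= size a -> sumn (take i b) <= sumn (take i a)
    & sumn b <= sumn a].

(* Main.v *)
Require Import Defs.
From mathcomp Require Import all_boot.
From mathcomp Require Import zify.

(* Log-convexity of the factorial gives b! * b^a <= a! * b^b for all a and b,
   strictly when a > b.  Multiplying these over the positions, with the shorter
   sequence padded by 0! = 1, it remains to bound the product of the b_i^(a_i - b_i)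
   from below by 1, which is Abel summation: the b_i are non-increasing and the
   partial sums of the a_i dominate those of the b_i.  For the equality case, at
   the first position where the sequences differ one has a_i > b_i, where the
   tangent inequality is strict. *)

Lemma leq_expn2r (m n e : nat) : m <= n -> m ^ e <= n ^ e.
Proof. by case: e => // e le_mn; rewrite leq_exp2r. Qed.

(** The quotient of the factorials is a product of [d] factors, each larger than [n] and at most
    [n + d]; this also gives the next two bounds. *)
Lemma fact_expn_leq (n d : nat) : n`! * n ^ d <= (n + d)`!.
Proof.
elim: d => [|d IHd]; first by rewrite muln1 addn0.
rewrite expnS mulnCA addnS factS leq_mul // -addnS.
exact: leq_addr.
Qed.

Lemma fact_expn_ltn (n d : nat) : 0 < d -> n`! * n ^ d < (n + d)`!.
Proof.
case: d => // d _; rewrite expnS mulnCA addnS factS.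
apply: leq_ltn_trans (_ : n * (n + d)`! < _).
  by rewrite leq_mul2l fact_expn_leq orbT.
by rewrite ltn_mul2r fact_gt0 ltnS leq_addr.
Qed.

Lemma fact_leq_expn (n d : nat) : (n + d)`! <= n`! * (n + d) ^ d.
Proof.
elim: d => [|d IHd]; first by rewrite addn0 muln1.
rewrite addnS factS expnS mulnCA leq_mul2l (leq_trans IHd) ?orbT //.
by rewrite leq_mul2l leq_expn2r ?orbT.
Qed.

(** The extra factor [b ^ d] keeps the exponent of [b] a natural number even when [a < b]. *)
Lemma fact_tangent (a b d : nat) :
  b <= d + a -> b`! * b ^ (d + a - b) <= b ^ d * a`!.
Proof.
move=> le_b_da; case: (leqP b a) => [le_ba|/ltnW le_ab].
  have := fact_expn_leq b (a - b); rewrite subnKC // => le_fact.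
  by rewrite -addnBA // expnD mulnCA leq_mul2l le_fact orbT.
have := fact_leq_expn a (b - a); rewrite subnKC // => le_fact.
have -> : b ^ d = b ^ (b - a) * b ^ (d + a - b) by rewrite -expnD; congr (_ ^ _); lia.
by rewrite mulnAC [_ * a`!]mulnC leq_mul2r le_fact orbT.
Qed.

Lemma prod_fact_gt0 (s : seq nat) : 0 < \prod_(x <- s) x`!.
Proof. by apply: prodn_gt0 => x; exact: fact_gt0. Qed.

(* [d] is the surplus of the partial sums over the entries already removed, and
   [c] bounds the remaining entries of [b]. *)
Lemma prod_fact_leq_surplus (a b : seq nat) (c d : nat) :
  0 < c -> path geq c b -> all (leq 1) b ->
  (forall i, sumn (take i b) <= d + sumn (take i a)) ->
  \prod_(x <- b) x`! <= c ^ d * \prod_(x <- a) x`!.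
Proof.
elim: b a c d => [|b0 b IHb] a c d c_gt0 /=.
  by rewrite big_nil muln_gt0 expn_gt0 c_gt0 prod_fact_gt0.
case/andP=> le_b0c path_b /andP[b0_gt0 b_gt0] le_sum.
(* If [a] is already exhausted, [a0 = 0] pads it without changing the product, as 0! = 1. *)
have [a0 [s [le_sum_s ->]]] : exists a0 s,
    (forall i, b0 + sumn (take i b) <= d + (a0 + sumn (take i s))) /\
    \prod_(x <- a) x`! = a0`! * \prod_(x <- s) x`!.
  case: a le_sum => [|a0 s] le_sum; last first.
    by exists a0, s; rewrite big_cons; split=> // i; apply: (le_sum i.+1).
  by exists 0, [::]; rewrite !big_nil; split=> // i; apply: (le_sum i.+1).
have le_b0 : b0 <= d + a0 by have := le_sum_s 0; rewrite !take0 /= !addn0.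
(* Once the heads are removed the surplus is [d + a0 - b0], and [b0] bounds what remains of [b]. *)
have le_tail : \prod_(x <- b) x`! <= b0 ^ (d + a0 - b0) * \prod_(x <- s) x`!.
  by apply: IHb => // i; have := le_sum_s i; lia.
rewrite big_cons; apply: leq_trans (leq_mul (leqnn _) le_tail) _.
rewrite !mulnA leq_mul2r; apply/orP; right.
apply: leq_trans (fact_tangent _ _ _ le_b0) _.
by rewrite leq_mul2r leq_expn2r ?orbT.
Qed.

Lemma prod_fact_leq (a b : seq nat) :
  sorted geq b -> all (leq 1) b ->
  (forall i, sumn (take i b) <= sumn (take i a)) ->
  \prod_(x <- b) x`! <= \prod_(x <- a) x`!.
Proof.
case: b => [|b0 b] sorted_b b_gt0 le_sum; first by rewrite big_nil prod_fact_gt0.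
have := @prod_fact_leq_surplus a (b0 :: b) b0 0; rewrite mul1n; apply=> //.
  by case/andP: b_gt0.
by rewrite /= leqnn.
Qed.

Lemma prod_fact_inj (a b : seq nat) :
  sorted geq b -> all (leq 1) b -> size a <= size b ->
  (forall i, sumn (take i b) <= sumn (take i a)) ->
  \prod_(x <- a) x`! = \prod_(x <- b) x`! -> a = b.
Proof.
elim: b a => [|b0 b IHb] [|a0 a] //= path_b /andP[b0_gt0 b_gt0] le_size le_sum.
  by have := le_sum 1; rewrite /= take0; case: b0 b0_gt0 {path_b le_sum}.
have le_b0a0 : b0 <= a0 by have := le_sum 1; rewrite /= !take0 /= !addn0.
rewrite !big_cons => eq_prod.
case: (ltngtP b0 a0) le_b0a0 => // [lt_b0a0|eq_b0a0] _.
  (* The tails may lose a factor [b0 ^ (a0 - b0)], but the heads gain strictly more, so the products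
     cannot agree. *)
  have le_tail : \prod_(x <- b) x`! <= b0 ^ (a0 - b0) * \prod_(x <- a) x`!.
    apply: prod_fact_leq_surplus => // i.
    by have := le_sum i.+1; rewrite /=; lia.
  have lt_fact : b0`! * b0 ^ (a0 - b0) < a0`!.
    by rewrite -[X in _ < X`!](subnKC (ltnW lt_b0a0)) fact_expn_ltn ?subn_gt0.
  have := leq_mul (leqnn b0`!) le_tail.
  by rewrite -eq_prod mulnA leq_mul2r leqNgt lt_fact orbF eqn0Ngt prod_fact_gt0.
rewrite eq_b0a0 in le_sum eq_prod *; congr (_ :: _); apply: IHb => //.
- exact: path_sorted path_b.
- by move=> i; have := le_sum i.+1; rewrite /= leq_add2l.
- by move/eqP: eq_prod; rewrite eqn_pmul2l ?fact_gt0 // => /eqP.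
Qed.

(** Past the end of [a] its prefix sum is the total, which bounds [sumn b] and hence every prefix
    sum of [b]. *)
Lemma majorizes_sumn_take (a b : seq nat) (i : nat) :
  majorizes a b -> sumn (take i b) <= sumn (take i a).
Proof.
case=> _ le_take le_sum; case: (leqP i (size a)) => [/le_take//|/ltnW le_i].
rewrite [take i a]take_oversize //; apply: leq_trans le_sum.
by rewrite -[X in _ <= sumn X](cat_take_drop i) sumn_cat leq_addr.
Qed.

Theorem theorem2p1 (a b : seq nat)
    (ha : nonincreasing_pos a) (hb : nonincreasing_pos b)
    (hab : majorizes a b) :
  \prod_(x <- b) x`! <= \prod_(x <- a) x`! /\
  (\prod_(x <- a) x`! = \prod_(x <- b) x`! <->
     size a = size b /\ (forall j, j < size a -> nth 0 a j = nth 0 b j)).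
Proof.
have [sorted_b /allP b_gt0] := hb.
have le_sum i := majorizes_sumn_take a b i hab.
have [le_size _ _] := hab.
split; first exact: prod_fact_leq.
split=> [/prod_fact_inj-> //|[eq_size eq_nth]].
by rewrite (eq_from_nth eq_size eq_nth).
Qed.
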